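(* Let $G=(V,E)$ be a graph. If $G$ is resistance nonnegative, then any Kron reduction $\operatorname{kron}_U(G)$ of $G$, with $U\subset V$, is resistance nonnegative. If $G$ is resistance positive, then any Kron reduction $\operatorname{kron}_U(G)$ of $G$, with $U\subset V$, is resistance positive.
   Context: All graphs $G=(V,E)$ are finite, simple (no multi-edges), loopless and connected. Kron reduction: for a vertex subset $U\subset V$, write $U^c=V\setminus U$ and $\partial U=\{v\in U^c\mid uv\in E\text{ for some }u\in U\}$. The Kron reduction of $U$ in $G$, written $\operatorname{kron}_U(G)$, is the graph obtained from $G$ by removing $U$ and adding all possible edges between the vertices of $\partial U$. Resistance curvature: a spanning tree of $G$ is a maximal acyclic subset of edges $T\subseteq E$. For edge weights $c=(c_e)_{e\in E}$ with $0<c_e<\infty$, the relative resistance of $e\in E$ is $r_e(c)=\frac{\sum_{T\ni e}\prod_{t\in T}c_t}{\sum_{T}\prod_{t\in T}c_t}$, with sums over spanning trees $T$, and the resistance curvature of $v\in V$ is $p_v(c)=1-\frac12\sum_{uv\in E}r_{uv}(c)$ (sum over edges incident to $v$). $G$ is resistance nonnegative (RN) if there exist weights $c$ with $p_v(c)\ge 0$ for all $v\in V$, and resistance positive (RP) if there exist weights $c$ with $p_v(c)>0$ for all $v\in V$.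
   Formalization: The resistance nonnegative half fails for disconnected U (path a-b-x-c-y-d, U={x,y}); it is proved for U inducing a connected subgraph, and for every U with a clique added on the boundary of each component of U instead of on ∂U. *)

(* Defs.v *)
From HB Require Import structures.
From mathcomp Require Import all_boot all_order all_algebra.
From mathcomp Require Import boolp reals.

Set Implicit Arguments.
Unset Strict Implicit.
Unset Printing Implicit Defensive.

Import Order.TTheory GRing.Theory Num.Theory.

Record sgraph := SGraph {
  vertex :> finType;
  adj : rel vertex;
  adj_sym : symmetric adj;
  adj_irr : irreflexive adj }.

Arguments adj {s}.

Definition connected (G : sgraph) : Prop := forall x y : G, connect adj x y.

Section Kron.
Variables (G : sgraph) (U : {set G}).

Definition boundary : {set G} :=
  [set v | (v \notin U) && [exists u in U, adj u v]].

Definition adj_in : rel G := [rel x y | [&& x \in U, y \in U & adj x y]].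

(* The subgraph induced on U is connected (true for U = set0). *)
Definition connected_set : Prop := {in U &, forall x y, connect adj_in x y}.

(* For u in U, the connected component of u in the subgraph induced on U. *)
Definition component (u : G) : {set G} := [set w | connect adj_in u w].
End Kron.

Section KronGraphs.
Variables (G : sgraph) (U : {set G}).

Definition kron_adj : rel {v : G | v \notin U} :=
  [rel x y | (x != y) &&
    (adj (val x) (val y) ||
     (val x \in boundary U) && (val y \in boundary U))].

Lemma kron_adj_sym : symmetric kron_adj.
Proof.
move=> x y; rewrite /kron_adj /= eq_sym adj_sym; congr (_ && (_ || _)).
exact: andbC.
Qed.

Lemma kron_adj_irr : irreflexive kron_adj.
Proof. by move=> x; rewrite /kron_adj /= eqxx. Qed.

Definition kron : sgraph := SGraph kron_adj_sym kron_adj_irr.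

(* Here a clique is added on the boundary of each connected component of the
   subgraph induced on U, rather than on the boundary of U itself: this is the
   support of the Schur complement of a weighted Laplacian of G, and the result
   of eliminating the vertices of U one at a time. It is a spanning subgraph of
   kron, and the same graph when U is connected. On a path a-b-x-c-y-d with
   U = {x, y}, it is the path a-b-c-d while kron has the extra edge bd. *)
Definition kron_comp_adj : rel {v : G | v \notin U} :=
  [rel x y | (x != y) &&
    (adj (val x) (val y) ||
     [exists u in U, (val x \in boundary (component U u)) &&
                     (val y \in boundary (component U u))])].

Lemma kron_comp_adj_sym : symmetric kron_comp_adj.
Proof.
move=> x y; rewrite /kron_comp_adj /= eq_sym adj_sym; congr (_ && (_ || _)).
by apply: eq_existsb => u; congr (_ && _); apply: andbC.
Qed.

Lemma kron_comp_adj_irr : irreflexive kron_comp_adj.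
Proof. by move=> x; rewrite /kron_comp_adj /= eqxx. Qed.

Definition kron_comp : sgraph := SGraph kron_comp_adj_sym kron_comp_adj_irr.
End KronGraphs.

Section Trees.
Variable G : sgraph.

Definition edges : {set {set G}} := [set [set x; y] | x in G, y in G & adj x y].

Definition acyclic (F : {set {set G}}) : Prop :=
  forall s : seq G, (2 < size s)%N ->
    ~~ ucycleb [rel x y | [set x; y] \in F] s.

Definition spanning_tree (T : {set {set G}}) : bool :=
  maxset [pred F : {set {set G}} | (F \subset edges) && `[< acyclic F >]] T.
End Trees.

Local Open Scope ring_scope.

Section Curvature.
Variables (R : realType) (G : sgraph).

(* Weights are functions on all vertex sets, of which only the values on
   edges matter. *)
Definition positive_weights (c : {set G} -> R) : Prop :=
  forall e, e \in edges G -> 0 < c e.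

Definition relative_resistance (c : {set G} -> R) (e : {set G}) : R :=
  (\sum_(T : {set {set G}} | spanning_tree T && (e \in T)) \prod_(t in T) c t) /
  (\sum_(T : {set {set G}} | spanning_tree T) \prod_(t in T) c t).

Definition curvature (c : {set G} -> R) (v : G) : R :=
  1 - 2^-1 * \sum_(u : G | adj u v) relative_resistance c [set u; v].

Definition resistance_nonnegative : Prop :=
  exists2 c, positive_weights c & forall v, 0 <= curvature c v.

Definition resistance_positive : Prop :=
  exists2 c, positive_weights c & forall v, 0 < curvature c v.
End Curvature.

(* Main.v *)
Require Import Defs.
From mathcomp Require Import all_boot all_order all_algebra all_fingroup.
From mathcomp Require Import ring lra.
From mathcomp Require Import boolp reals.

(** Let w be the edge weights extended by 0.  By the matrix-tree theorem the
    relative resistance of an edge uv is w(u,v) omega(u,v), where omega is any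
    symmetric function, zero on the diagonal, solving
      sum_u w(x,u) (omega(x,v) - omega(u,v)) = 2 (p(x) - [x = v])
    for some p; taking x = v shows that p is then the resistance curvature.
    Such a system survives the star-mesh elimination of a vertex z,
      w'(x,y) = w(x,y) + w(x,z) w(z,y) / w(z),
      p'(x) = p(x) + w(x,z) p(z) / w(z),    w(z) = sum_u w(z,u),
    with the same omega, so curvatures that are nonnegative can only grow.
    Eliminating all of U leaves positive weights exactly between the vertices
    joined by an edge or by a path through U.  When the curvature is positive,
    any further edges can be added with a small weight t, because the sign of
    the curvature is that of a polynomial in t. *)

Set Implicit Arguments.
Unset Strict Implicit.
Unset Printing Implicit Defensive.

Import Order.TTheory GRing.Theory Num.Theory.
Local Open Scope ring_scope.

(** * Parent maps of trees rooted at [v] *)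

Section RootedMaps.
Variables (V : finType) (v : V).

Definition reaches (f : V -> V) : bool := [forall x, fconnect f x v].

Lemma reachesP (f : V -> V) : reflect (forall x, fconnect f x v) (reaches f).
Proof. exact: forallP. Qed.

(** The distance to the root is a height that drops along [f]; acyclicity is argued below by
    comparing such heights. *)
Lemma reaches_descent (f : V -> V) : reaches f ->
  forall x, x != v -> (findex f (f x) v < findex f x v)%N.
Proof. by move=> /reachesP fv x xv; rewrite (fconnect_findex (fv x)) // eq_sym. Qed.

Lemma descent_reaches (f : V -> V) (h : V -> nat) :
  (forall x, x != v -> (h (f x) < h x)%N) -> reaches f.
Proof.
move=> hf; apply/reachesP => x; elim: {x}(h x).+1 {-2}x (ltnSn (h x)) =>
  // n IH x hx.
have [-> //|xv] := eqVneq x v.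
by apply: connect_trans (fconnect1 f x) (IH _ _); apply: leq_trans (hf _ xv) _.
Qed.

Lemma reaches_neq (f : V -> V) x : reaches f -> x != v -> f x != x.
Proof. by move=> /reaches_descent fv /fv; apply: contraTneq => ->;
  rewrite ltnn. Qed.

(** Two non-root vertices that are each other's parent would never reach the root. Hence distinct
    non-root vertices have distinct parent edges. *)
Lemma reaches_neq2 (f : V -> V) x : reaches f -> x != v -> f x != v ->
  f (f x) != x.
Proof.
move=> /reaches_descent fv xv fxv; have := ltn_trans (fv _ fxv) (fv _ xv).
by apply: contraTneq => ->; rewrite ltnn.
Qed.

End RootedMaps.

(** * The matrix-tree theorem in terms of parent maps *)

Section MatrixTree.
Variables (F : fieldType) (V : finType) (v : V).

(* Row x is e_x - e_(f x), except row v, which is e_v. *)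
Definition parent_mx (f : V -> V) : 'M[F]_#|V| :=
  \matrix_(i, j) ((i == j)%:R -
    ((enum_val i != v) && (enum_val j == f (enum_val i)))%:R).

Lemma det_parent_mx_reaches f : reaches v f -> \det (parent_mx f) = 1.
Proof.
move=> fv; have desc := reaches_descent fv.
rewrite /determinant (bigD1 1%g) //= odd_perm1 expr0 mul1r.
rewrite [X in X + _]big1 ?[X in _ + X]big1 ?addr0 //.
(* A term moving some vertex i must send it to its parent; at a lowest such i
   the parent is fixed, contradicting injectivity. *)
- move=> s /eqP s1; apply/eqP; rewrite mulf_eq0 signr_eq0 /= prodf_seq_eq0.
  have /existsP[i0 i0P] : [exists i, s i != i].
    by apply/contra_notT: s1; rewrite negb_exists => /forallP H;
      apply/permP => i; rewrite perm1; apply/eqP; have := H i; rewrite negbK.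
  case: (@arg_minnP _ i0 (fun i => s i != i)
    (fun i => findex f (enum_val i) v) i0P) => i si min.
  apply/hasP; exists i; rewrite ?mem_index_enum // mxE /= [i == _]eq_sym (negPf
    si) sub0r oppr_eq0.
  case: andP => [[iv /eqP fi]|_]; last by rewrite eqxx.
  have := desc _ iv; rewrite -fi ltnNge => /negP[].
  by apply: min; apply: contraNneq si => /perm_inj ->.
- move=> i _; rewrite mxE perm1 eqxx; have [iv|iv] := eqVneq (enum_val i) v;
    first by rewrite subr0.
  by rewrite eq_sym (negPf (reaches_neq fv iv)) subr0.
Qed.

Lemma det_parent_mx_not_reaches f : ~~ reaches v f -> \det (parent_mx f) = 0.
Proof.
rewrite /reaches negb_forall => /existsP[x0 x0v].
(* The indicator of the vertices that never reach v is in the kernel. *)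
rewrite -det_tr; apply/eqP/det0P.
exists (\row_j (~~ fconnect f (enum_val j) v)%:R).
  by apply/eqP => /rowP/(_ (enum_rank x0)); rewrite !mxE enum_rankK x0v;
    move/eqP; rewrite oner_eq0.
apply/rowP => i; rewrite !mxE.
under eq_bigr do rewrite !mxE mulrBr.
rewrite sumrB (bigD1 i) //= eqxx mulr1 big1 ?addr0; last first.
  by move=> j ji; rewrite eq_sym (negPf ji) mulr0.
have [iv|iv] := eqVneq (enum_val i) v.
  by rewrite iv connect0 big1 ?subr0 // => j _; rewrite mulr0.
rewrite (bigD1 (enum_rank (f (enum_val i)))) //= enum_rankK eqxx mulr1 big1
  ?addr0; last first.
  by move=> j; rewrite -(inj_eq enum_val_inj) enum_rankK => /negPf ->;
    rewrite mulr0.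
apply/eqP; rewrite subr_eq0; apply/eqP; congr ((~~ _)%:R).
apply/idP/idP => [fi|]; last exact: connect_trans (fconnect1 _ _).
have := fconnect_findex fi; rewrite eq_sym iv => /(_ isT) E.
have := iter_findex fi; rewrite E iterSr => <-; exact: fconnect_iter.
Qed.

(** Row [x] combines the possible rows of [parent_mx] with coefficients [W x u], so multilinearity
    yields a sum over all maps [f] of weights times [\det (parent_mx f)], which is one or zero. *)
Lemma det_weighted_maps (W : V -> V -> F) :
  \det (\matrix_(i < #|V|, j < #|V|) \sum_u W (enum_val i) u *
     ((i == j)%:R - ((enum_val i != v) && (enum_val j == u))%:R))
  = \sum_(f : {ffun V -> V} | reaches v f) \prod_x W x (f x).
Proof.
have bij_ev : bijective (@enum_val V V) by apply: enum_val_bij.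
rewrite [RHS]big_mkcond /=.
(* Both sides are expanded over permutations; for each of them a product of sums is then distributed
   into a sum over maps. *)
under [RHS]eq_bigr => f _.
  have -> : (if reaches v f then \prod_x W x (f x) else 0)
      = \sum_s (-1) ^+ odd_perm s * \prod_i (W (enum_val i) (f (enum_val i)) *
        parent_mx f i (s i)).
    rewrite (reindex _ (onW_bij _ bij_ev)) /=.
    under [RHS]eq_bigr do rewrite big_split /= mulrCA.
    rewrite -mulr_sumr; case: ifPn => fv.
      by rewrite -[X in _ = _ * X]/(\det _) det_parent_mx_reaches ?mulr1.
    by rewrite -[X in _ = _ * X]/(\det _) det_parent_mx_not_reaches ?mulr0.
  over.
rewrite exchange_big /=; apply: eq_bigr => s _; rewrite -mulr_sumr; congr (_ * _).
under eq_bigr do rewrite mxE.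
rewrite bigA_distr_bigA /=.
rewrite (reindex (fun f : {ffun V -> V} => [ffun i : 'I_#|V| =>
  f (enum_val i)])) /=; last first.
  exists (fun g : {ffun 'I_#|V| -> V} => [ffun x => g (enum_rank x)]) => f _;
    apply/ffunP => x; rewrite !ffunE.
    by rewrite enum_rankK.
  by rewrite enum_valK.
by apply: eq_bigr => f _; apply: eq_bigr => i _; rewrite ffunE mxE.
Qed.

End MatrixTree.

(* For S = [set v], the sum over spanning trees oriented towards v, each encoded
   by its parent map; for S = [set u; v], over those containing the edge uv, with
   that edge left out of the weight. *)
Definition treesum (F : comPzRingType) (V : finType) (v : V) (S : {set V})
    (w : V -> V -> F) : F :=
  \sum_(f : {ffun V -> V} | reaches v f && [forall x in S, f x == v])
    \prod_(x | x \notin S) w x (f x).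

(** * Tree sums as determinants, and their ratios *)

Section TreeSums.
Variables (F : fieldType) (V : finType) (v : V).

(** Weight one on the parent [v] and zero on any other forces the parent of a vertex of [S] and
    drops its own weight from the product. *)
Definition rooted_weight (S : {set V}) (w : V -> V -> F) (x u : V) : F :=
  if x \in S then (u == v)%:R else w x u.

(** For [S = [set v]] this is the Laplacian with row [v] replaced by e_v; putting another vertex u
    into [S] replaces row u by e_u - e_v. *)
Definition tree_mx (S : {set V}) (w : V -> V -> F) : 'M[F]_#|V| :=
  \matrix_(i, j) \sum_u rooted_weight S w (enum_val i) u *
     ((i == j)%:R - ((enum_val i != v) && (enum_val j == u))%:R).

Lemma treesum_det S w : treesum v S w = \det (tree_mx S w).
Proof.
rewrite det_weighted_maps /treesum big_mkcondr /=; apply: eq_bigr => f _.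
case: ifPn => [/forall_inP fS | ].
  rewrite [RHS](bigID (mem S)) /= [X in _ = X * _]big1 ?mul1r; last first.
    by move=> x xS; rewrite /rooted_weight xS fS.
  by apply: eq_bigr => x xS; rewrite /rooted_weight (negPf xS).
rewrite negb_forall_in => /exists_inP[x xS fx].
by rewrite (bigD1 x) //= /rooted_weight xS (negPf fx) mul0r.
Qed.

Lemma tree_mx_mul S w (phi : V -> F) i :
  (tree_mx S w *m \col_j phi (enum_val j)) i 0 =
  \sum_u rooted_weight S w (enum_val i) u *
    (phi (enum_val i) - (enum_val i != v)%:R * phi u).
Proof.
rewrite !mxE; under eq_bigr do rewrite !mxE mulr_suml.
rewrite exchange_big /=; apply: eq_bigr => u _.
under eq_bigr do rewrite -mulrA mulrBl.
rewrite -mulr_sumr sumrB; congr (_ * (_ - _)).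
  rewrite (bigD1 i) //= eqxx mul1r big1 ?addr0 // => j ji.
  by rewrite eq_sym (negPf ji) mul0r.
rewrite (bigD1 (enum_rank u)) //= enum_rankK eqxx andbT big1 ?addr0 // => j.
by rewrite -(inj_eq enum_val_inj) enum_rankK => /negPf ->; rewrite andbF mul0r.
Qed.

End TreeSums.

(** Applying the adjugate to the equation for [phi] shows that the cofactors of [A] along row [i0]
    are the entries of [\det A *: phi]. They are also those of [B], whose determinant is expanded
    along that row. *)
Lemma det_replace_row (F : comPzRingType) n (A B : 'M[F]_n) (i0 : 'I_n) (phi :
  'cV[F]_n) :
  (forall i j, i != i0 -> B i j = A i j) -> A *m phi = delta_mx i0 0 ->
  \det B = \det A * (B *m phi) i0 0.
Proof.
move=> BA Aphi; rewrite (expand_det_row _ i0).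
have adjA j : \adj A j i0 = \det A * phi j 0.
  transitivity ((\adj A *m (A *m phi)) j 0).
    rewrite Aphi [RHS]mxE (bigD1 i0) //= [delta_mx _ _ _ _]mxE !eqxx mulr1 big1
      ?addr0 // => k ki.
    by rewrite [delta_mx _ _ _ _]mxE (negPf ki) mulr0.
  by rewrite mulmxA mul_adj_mx mul_scalar_mx mxE.
rewrite mxE mulr_sumr; apply: eq_bigr => j _; rewrite [RHS]mulrCA -adjA [in RHS]mxE.
congr (_ * (_ * \det _)); apply/matrixP => k l; rewrite !mxE.
by apply: BA; rewrite eq_sym neq_lift.
Qed.

(* L omega = 2 (p 1^T - I) for the Laplacian L of w on A; the diagonal of w is
   irrelevant. *)
Definition resistance_system (F : pzRingType) (V : finType) (A : {set V})
    (w omega : V -> V -> F) (p : V -> F) : Prop :=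
  {in A &, forall x y, \sum_(u in A) w x u * (omega x y - omega u y)
     = 2 * (p x - (x == y)%:R)}.

(** The two tree matrices differ only in row [u], and the one for [[set v]] sends the potential
    [phi] of a unit current to e_u. The ratio of determinants is therefore [phi u - phi v], which is
    [omega u v]. *)
Lemma treesum_resistance (F : realFieldType) (V : finType)
    (w omega : V -> V -> F) (p : V -> F) (u v : V) :
  (forall x y, omega x y = omega y x) -> (forall x, omega x x = 0) ->
  resistance_system setT w omega p -> u != v ->
  treesum v [set u; v] w = treesum v [set v] w * omega u v.
Proof.
move=> symo diago sys uv.
(* The potential of a unit current from u to v, grounded at v. *)
pose phi x := (omega x v - omega x u + omega u v) / 2.
rewrite !treesum_det.
rewrite (@det_replace_row _ _ (tree_mx v [set v] w) _ (enum_rank u) (\col_j phi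
  (enum_val j))).
- congr (_ * _); rewrite tree_mx_mul enum_rankK uv.
  rewrite (bigD1 v) //= big1 ?addr0; last first.
    by move=> y /negPf yv; rewrite /rooted_weight set21 yv mul0r.
  rewrite /rooted_weight set21 eqxx !mul1r /phi !diago (symo v u); lra.
- move=> i j iu; rewrite !mxE; apply: eq_bigr => y _; congr (_ * _).
  by rewrite /rooted_weight !inE -(inj_eq enum_val_inj) enum_rankK in iu *;
    rewrite (negPf iu).
apply/colP => i; rewrite tree_mx_mul mxE eqxx andbT -(inj_eq enum_val_inj)
  enum_rankK.
move: (enum_val i) => x {i}.
have [-> | xv] := eqVneq x v.
  rewrite [v == u]eq_sym (negPf uv) big1 // => y _.
  by rewrite mul0r subr0 /phi diago (symo v u) sub0r addNr mul0r mulr0.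
have sysE y : \sum_z w x z * (omega x y - omega z y) = 2 * (p x - (x == y)%:R).
  by rewrite -sys ?in_setT //; apply: eq_bigl => z; rewrite in_setT.
(* In the difference of the systems for [v] and for [u], the term [p x] cancels. *)
transitivity ((\sum_y w x y * (omega x v - omega y v) - \sum_y w x y * (omega x u
  - omega y u)) / 2).
  rewrite -sumrB mulr_suml; apply: eq_bigr => y _.
  by rewrite /rooted_weight !inE (negPf xv) mul1r /phi; field.
rewrite !sysE (negPf xv); case: (x == u) => /=; lra.
Qed.

Lemma eq_set2 (T : finType) (x y a b : T) :
  [set x; y] = [set a; b] -> (x = a /\ y = b) \/ (x = b /\ y = a).
Proof.
move=> /setP E; have := (E x, E y, E a, E b); rewrite !inE !eqxx !orbT /=.
case=> [[[/esym/orP[]/eqP ? /esym/orP[]/eqP ?] /orP[]/eqP ?] /orP[]/eqP ?];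
  intuition congruence.
Qed.

Lemma edges_adj (G : sgraph) (x y : G) : ([set x; y] \in edges G) = adj x y.
Proof.
apply/imset2P/idP => [[a b _]|xy]; last by exists x y; rewrite ?inE.
by rewrite !inE => ab /eq_set2[[-> ->]|[-> ->]] //; rewrite adj_sym.
Qed.

(** * Spanning trees as parent maps *)

Section RootedTrees.
Variables (G : sgraph) (v : G).

Definition tree_of (f : G -> G) : {set {set G}} :=
  [set [set x; f x] | x in [set~ v]].

Lemma in_tree_of f x y : reflect ((x != v /\ f x = y) \/ (y != v /\ f y = x))
  ([set x; y] \in tree_of f).
Proof.
apply: (iffP imsetP) => [[z] | [[xv <-]|[yv <-]]].
- by rewrite !inE => zv /eq_set2[[-> ->]|[-> ->]]; [left|right].
- by exists x; rewrite ?inE.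
- by exists y; rewrite ?inE // setUC.
Qed.

(** On a cycle, both neighbours of a vertex farthest from the root would be its parent, hence
    equal. *)
Lemma tree_of_acyclic f : reaches v f -> acyclic (tree_of f).
Proof.
move=> fv s s2; apply/negP => /andP[cs us].
have [x0 x0s] : exists x, x \in s by case: (s) s2 => // x ? _; exists x;
  rewrite mem_head.
have [x xs xmax] := arg_maxnP (fun x => findex f x v) x0s.
have {}xmax y : y \in s -> [set x; y] \in tree_of f -> y = f x.
  move=> ys /in_tree_of[[_ ->] //|[yv fy]]; have := reaches_descent fv yv.
  by rewrite fy ltnNge; have /= -> := xmax _ ys.
have [i s' si] := rot_to xs.
rewrite -(rot_cycle i) -(rot_uniq i) -(size_rot i) si in cs us s2.
have ms y : y \in x :: s' -> y \in s by rewrite -si mem_rot.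
case: s' => [|y [|z q]] in si cs us s2 ms * => //.
move: cs; rewrite /= -cats1 cat_path /= andbT => /and4P[xy _ _ zx].
move: us => /= /and4P[_ yzq _ _]; case/negP: yzq.
rewrite (_ : y = last z q) ?mem_last //.
rewrite (xmax y) ?ms ?inE ?eqxx ?orbT //; symmetry; apply: xmax;
  last by rewrite setUC.
by apply: ms; rewrite !inE; have := mem_last z q; rewrite inE => ->; rewrite !orbT.
Qed.

Lemma tree_of_connect f : reaches v f -> forall x y,
  connect [rel x y | [set x; y] \in tree_of f] x y.
Proof.
move=> fv; have sym : connect_sym [rel x y | [set x; y] \in tree_of f].
  by apply: sym_connect_sym => x y /=; rewrite setUC.
suff cv x : connect [rel x y | [set x; y] \in tree_of f] x v.
  by move=> x y; apply: connect_trans (cv x) _; rewrite sym.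
elim: {x}(findex f x v).+1 {-2}x (ltnSn (findex f x v)) => // n IH x hx.
have [-> //|xv] := eqVneq x v.
apply: connect_trans (connect1 _) (IH (f x) _).
  by apply/in_tree_of; left.
exact: leq_trans (reaches_descent fv xv) _.
Qed.

(** For maximality: an edge outside the tree closes a cycle with the tree path between its ends. *)
Lemma tree_of_spanning f : reaches v f -> (forall x, x != v -> adj x (f x)) ->
  spanning_tree (tree_of f).
Proof.
move=> fv fadj; apply/maxsetP; split => [|B /= /andP[Be /asboolP Ba] fB].
  rewrite /=; apply/andP; split; last by apply/asboolP; exact: tree_of_acyclic.
  by apply/subsetP => e /imsetP[x]; rewrite !inE => xv ->; rewrite edges_adj fadj.
apply/eqP; rewrite eqEsubset fB andbT; apply/subsetP => e eB.
have /imset2P[x y _] := subsetP Be _ eB; rewrite !inE => xy E; subst e.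
case/connectP: (tree_of_connect fv x y) => p0 /shortenP[p pp up _] yl.
case: p pp up yl => [|z [|z' q]] pp up yl.
- by rewrite yl /= adj_irr in xy.
- by move: pp; rewrite /= andbT yl.
have := Ba [:: x, z, z' & q] isT; rewrite /ucycleb up andbT => /negP[].
rewrite /= -cats1 cat_path /=; move: yl pp => /= <- /and3P[xz zz' pq].
rewrite [[set y; x]]setUC eB andbT !(subsetP fB) //=.
by rewrite andbT; apply: sub_path pq => a b /=; apply: (subsetP fB).
Qed.

(** At a disagreement [x] nearest to the root, the shared edge [[set x; f x]] forces [g (f x) = x].
    Since [f] and [g] agree at [f x], the map [f] would have a cycle of length two. *)
Lemma tree_of_inj f g : reaches v f -> f v = v -> g v = v ->
  tree_of f = tree_of g -> f =1 g.
Proof.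
move=> fv frv grv E x; apply/eqP; apply: contraT => fgx0.
have [{fgx0}x fgx xmin] := arg_minnP (fun x => findex f x v) (fgx0 : [pred x | f
  x != g x] x).
have xv : x != v by apply: contraNneq fgx => /= ->; rewrite frv grv.
have : [set x; f x] \in tree_of g by rewrite -E; apply/in_tree_of; left.
case/in_tree_of => [[_ gx]|[fxv gfx]]; first by rewrite /= gx eqxx in fgx.
have fgfx : f (f x) = g (f x).
  apply/eqP; apply: contraT => /xmin.
  by rewrite leqNgt (reaches_descent fv xv).
by have := reaches_neq2 fv xv fxv; rewrite fgfx gfx eqxx.
Qed.

(** If the ends of an edge of [G] were not joined in [T], adding that edge would close no cycle,
    against maximality. *)
Lemma spanning_tree_connect (T : {set {set G}}) : connected G -> spanning_tree T ->
  forall x y, connect [rel x y | [set x; y] \in T] x y.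
Proof.
move=> cG /maxsetP[/= /andP[Te /asboolP Ta] Tmax] x y.
apply: connect_sub (cG x y) => {}x {}y /= xy.
apply/negPn/negP => nxy.
have sym : connect_sym [rel x y | [set x; y] \in T].
  by apply: sym_connect_sym => a b /=; rewrite setUC.
suff /Tmax E : ([set x; y] |: T \subset edges G) &&
    `[< acyclic ([set x; y] |: T) >].
  by case/negP: nxy; rewrite connect1 //= -E ?subsetUr // setU11.
apply/andP; split; first by rewrite subUset sub1set edges_adj xy.
apply/asboolP => s s2; apply/negP => /andP[cs us].
have := Ta s s2; rewrite /ucycleb us andbT => /negP[].
(* A step of the cycle outside [T] can only be the new edge, and the rest of the cycle then joins
   its ends inside [T]. *)
apply: cycle_from_next => // a sa /=.
apply/negPn/negP => naT; case/negP: nxy.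
have nab : [set a; next s a] = [set x; y].
  by have := next_cycle cs sa; rewrite /= !inE (negPf naT) orbF => /eqP.
have [i s' si] := rot_to sa.
rewrite -(next_rot i us) in nab.
rewrite -(rot_cycle i) -(rot_uniq i) -(size_rot i) in cs us s2.
rewrite {}si in nab cs us s2.
case: s' => [|b [|c q]] in nab cs us s2 => //.
rewrite /= eqxx in nab.
suff ba : connect [rel x y | [set x; y] \in T] b a.
  by case/esym/eq_set2: nab => [[-> ->]|[-> ->]] //; rewrite sym.
have FT d e : [set d; e] \in [set x; y] |: T ->
    (d != b) && (d != a) || (e != b) && (e != a) -> [set d; e] \in T.
  rewrite !inE => /orP[/eqP|//]; rewrite -nab => /eq_set2[] [-> ->];
    by rewrite !eqxx ?andbF.
move: us; rewrite /= !inE !negb_or => /and4P[/and3P[ab ac aq] /andP[bc bq] cq uq].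
move: cs; rewrite /= -cats1 cat_path /= andbT => /and4P[_ bcT cqT qaT].
apply: (connect_trans (connect1 (_ : [rel x y | [set x; y] \in T] b c))).
  by apply: FT => //; rewrite [c == b]eq_sym [c == a]eq_sym bc ac orbT.
have nl d : d \in c :: q -> (d != b) && (d != a).
  by rewrite inE => /orP[/eqP ->|dq]; rewrite 1?eq_sym ?bc 1?eq_sym ?ac //;
    apply/andP; split; [apply: contraNneq bq => <-|apply: contraNneq aq => <-].
apply: (connect_trans (_ : connect _ c (last c q)) (connect1 _)).
  apply/connectP; exists q => //.
  apply: (sub_in_path (P := mem (c :: q))) cqT; last exact/allP.
  by move=> d e dc ec /= /FT; apply; rewrite (nl d).
by apply: FT => //=; rewrite (nl _ (mem_last c q)).
Qed.

(** The parent of [x] is the next vertex on a shortest path to [v] in [T]. The resulting tree lies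
    in [T] and, being maximal, equals the acyclic set [T]. *)
Lemma spanning_tree_of (T : {set {set G}}) : connected G -> spanning_tree T ->
  exists f : {ffun G -> G}, [/\ f v = v, reaches v f,
    forall x, x != v -> adj x (f x) & T = tree_of f].
Proof.
move=> cG sT; have cT := spanning_tree_connect cG sT.
pose e := [rel x y | [set x; y] \in T].
have exd x : exists n, `[< exists p, [/\ path e x p, last x p = v & size p = n] >].
  by have /connectP[p pp pv] := cT x v; exists (size p); apply/asboolP; exists p.
pose d x := ex_minn (exd x).
have /boolp.choice[f fP] : forall x, exists y, if x == v then y = v else e x y /\
  (d y < d x)%N.
  move=> x; have [xv|xv] := eqVneq x v; first by exists v.
  rewrite [d x]/d; case: ex_minnP => n /asboolP[[|y p] [pp pv pn]] _.
    by rewrite -pv /= eqxx in xv.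
  move: pp => /= /andP[xy yp]; exists y; split=> //; rewrite -pn /d.
  by case: ex_minnP => m _; apply; apply/asboolP; exists p.
have fV x : x != v -> e x (f x) /\ (d (f x) < d x)%N by move=> xv; have := fP x;
  rewrite (negPf xv).
have fv : reaches v [ffun x => f x].
  by apply: (@descent_reaches _ _ _ d) => x xv; rewrite ffunE; case: (fV x xv).
move: sT => /maxsetP[/= /andP[Te /asboolP Ta] Tmax].
have fadj x : x != v -> adj x ([ffun x => f x] x).
  by move=> xv; rewrite ffunE -edges_adj; apply: (subsetP Te); case: (fV x xv).
exists [ffun x => f x]; split=> //; first by have := fP v; rewrite ffunE eqxx.
have /maxsetP[_] := tree_of_spanning fv fadj.
apply; first by rewrite /= Te; apply/asboolP.
by apply/subsetP => a /imsetP[x]; rewrite !inE ffunE => xv ->; case: (fV x xv).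
Qed.

(** A tree determines its parent map except at the root; fixing [f v = v] makes the correspondence
    one to one. *)
Lemma sum_spanning_trees (R : comPzRingType) (P : pred {set {set G}})
    (c : {set G} -> R) :
  connected G ->
  \sum_(T : {set {set G}} | spanning_tree T && P T) \prod_(t in T) c t =
  \sum_(f : {ffun G -> G} | [&& reaches v f, f v == v,
    [forall x, (x != v) ==> adj x (f x)] & P (tree_of f)])
    \prod_(x | x != v) c [set x; f x].
Proof.
move=> cG.
pose A : pred {ffun G -> G} := [pred f : {ffun G -> G} | [&& reaches v f, f v ==
  v, [forall x, (x != v) ==> adj x (f x)] & P (tree_of f)]].
have injA : {in A &, injective (fun f : {ffun G -> G} => tree_of f)}.
  move=> f g /and4P[fv /eqP fvv _ _] /and4P[_ /eqP gvv _ _] E.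
  by apply/ffunP; apply: tree_of_inj fv fvv gvv E.
transitivity (\sum_(T in [set tree_of f | f : {ffun G -> G} in A]) \prod_(t in T)
  c t).
  apply: eq_bigl => T; apply/idP/imsetP => [/andP[sT PT]|[f /and4P[fv _
    /forall_inP fadj Pf] ->]].
    have [f [fvv fv fadj E]] := spanning_tree_of cG sT.
    exists f => //; rewrite !inE fv fvv eqxx -E PT andbT /=; exact/forall_inP.
  by rewrite Pf andbT tree_of_spanning.
rewrite (big_imset _ injA); apply: eq_bigr => f /and4P[fv _ _ _].
rewrite big_imset /=; first by apply: eq_bigl => x; rewrite !inE.
move=> x y; rewrite !inE => xv yv /eq_set2[[]//|[xy fxy]].
by have := reaches_neq2 fv xv; rewrite fxy => /(_ yv); rewrite -xy eqxx.
Qed.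

End RootedTrees.

(** * Relative resistance and curvature through tree sums *)

Section RelativeResistance.
Variables (R : realType) (G : sgraph).
Hypothesis cG : connected G.
Variable c : {set G} -> R.

Definition conductance (x y : G) : R := if adj x y then c [set x; y] else 0.

Lemma conductance_sym x y : conductance x y = conductance y x.
Proof. by rewrite /conductance adj_sym setUC. Qed.

Lemma sum_adj_maps (v : G) (Q : pred {ffun G -> G}) :
  \sum_(f : {ffun G -> G} | [&& reaches v f, f v == v,
    [forall x, (x != v) ==> adj x (f x)] & Q f])
    \prod_(x | x != v) c [set x; f x] =
  \sum_(f : {ffun G -> G} | [&& reaches v f, f v == v & Q f])
    \prod_(x | x != v) conductance x (f x).
Proof.
rewrite big_mkcond [RHS]big_mkcond; apply: eq_bigr => f _ /=.
case: (reaches v f) => //=; case: (f v == v) => //=; case: (Q f);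
  rewrite ?andbF ?andbT //.
case: ifPn => [/forall_inP fadj | ].
  by apply: eq_bigr => x xv; rewrite /conductance fadj.
rewrite negb_forall_in => /exists_inP[x xv nadj].
by rewrite (bigD1 x) //= /conductance (negPf nadj) mul0r.
Qed.

Lemma sum_spanning_treesum v :
  \sum_(T : {set {set G}} | spanning_tree T) \prod_(t in T) c t =
  treesum v [set v] conductance.
Proof.
under eq_bigl do rewrite -[spanning_tree _]andbT.
rewrite (sum_spanning_trees v predT c cG) sum_adj_maps; apply: eq_big => [f|f _].
  congr (_ && _); rewrite andbT; apply/idP/forall_inP => [fv x|];
    first by rewrite inE => /eqP ->.
  by apply; rewrite set11.
by apply: eq_bigl => x; rewrite inE.
Qed.

(** In a tree rooted at [v], the edge [[set u; v]] occurs exactly when the parent of [u] is [v], so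
    its weight is a common factor. *)
Lemma sum_spanning_treesum_edge u v : adj u v ->
  \sum_(T : {set {set G}} | spanning_tree T && ([set u; v] \in T)) \prod_(t in T) c t =
  conductance u v * treesum v [set u; v] conductance.
Proof.
move=> uv; have {}uv : u != v by apply: contraTneq uv => ->; rewrite adj_irr.
rewrite (sum_spanning_trees v [pred T : {set {set G}} | [set u; v] \in T] c cG).
rewrite (sum_adj_maps v [pred f : {ffun G -> G} | [set u; v] \in tree_of v f]) mulr_sumr.
apply: eq_big => [f|f /and3P[_ _ /in_tree_of[[_ fu]|[]]]]; last by rewrite eqxx.
  congr (_ && _); apply/andP/forall_inP => [[fv /in_tree_of[[_ fu] x|[]]] | fv];
    last first.
  - by split; [|apply/in_tree_of; left; split=> //; apply/eqP]; apply: fv;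
      rewrite !inE eqxx ?orbT.
  - by rewrite eqxx.
  by rewrite !inE => /orP[]/eqP ->; rewrite ?fu.
rewrite (bigD1 u) //= fu; congr (_ * _); apply: eq_bigl => x.
by rewrite !inE negb_or andbC.
Qed.

Lemma relative_resistance_treesum u v : adj u v ->
  relative_resistance c [set u; v] =
  conductance u v * treesum v [set u; v] conductance / treesum v [set v]
    conductance.
Proof.
by move=> uv; rewrite /relative_resistance sum_spanning_treesum_edge //
  (sum_spanning_treesum v).
Qed.

Lemma curvature_treesum v : curvature c v =
  1 - 2^-1 * \sum_u conductance u v * treesum v [set u; v] conductance / treesum v [set v] conductance.
Proof.
rewrite /curvature; congr (1 - _ * _); rewrite [LHS]big_mkcond;
  apply: eq_bigr => u _.
case: ifPn => [uv|nuv]; first exact: relative_resistance_treesum.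
by rewrite /conductance (negPf nuv) !mul0r.
Qed.

Hypothesis c0 : positive_weights c.

(** A spanning tree exists because the empty acyclic set extends to a maximal one. *)
Lemma treesum_gt0 v : 0 < treesum v [set v] conductance.
Proof.
rewrite -sum_spanning_treesum.
have [T sT _] : {T : {set {set G}} | spanning_tree T & set0 \subset T}.
  apply: maxset_exists; rewrite /= sub0set; apply/asboolP => -[|x [|y s]] //= _.
  by rewrite /ucycleb /= inE.
have prod_gt0 (S : {set {set G}}) : spanning_tree S -> 0 < \prod_(t in S) c t.
  move=> /maxsetP[/andP[/subsetP Se _] _]; apply: prodr_gt0 => t /Se; exact: c0.
rewrite (bigD1 T) //= ltr_pwDl ?prod_gt0 // sumr_ge0 // => S /andP[sS _].
exact/ltW/prod_gt0.
Qed.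

Lemma curvature_resistance (omega : G -> G -> R) (p : G -> R) :
  (forall x y, omega x y = omega y x) -> (forall x, omega x x = 0) ->
  resistance_system setT conductance omega p -> forall v, curvature c v = p v.
Proof.
move=> symo diago sys v; rewrite curvature_treesum.
have /= := sys v v (in_setT _) (in_setT _); rewrite eqxx => sysv.
(* This brings out the right-hand side of the system at [x = y = v]. *)
rewrite (_ : p v = 1 + 2^-1 * (2 * (p v - 1))); last by field.
rewrite -{}sysv -mulrN -sumrN; congr (1 + _ * _); apply: eq_big => [u|u _];
  first by rewrite in_setT.
have [->|uv] := eqVneq u v; first by rewrite /conductance adj_irr !mul0r oppr0.
rewrite (treesum_resistance symo diago sys uv) diago sub0r mulrN conductance_sym.
by congr (- _); field; rewrite gt_eqF ?treesum_gt0.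
Qed.
End RelativeResistance.

(** The witness is the effective resistance [g x x + g y y - 2 * g x y], with [g] the inverse of a
    grounded Laplacian; [p] is half the Laplacian of the diagonal of [g], plus one at the ground
    [r]. *)
Lemma resistance_exists (R : realFieldType) (V : finType) (w : V -> V -> R) :
  (forall x y, w x y = w y x) -> (forall x y, 0 <= w x y) ->
  (forall x y, connect [rel x y | 0 < w x y] x y) ->
  exists omega p, [/\ forall x y, omega x y = omega y x, forall x, omega x x = 0
    & resistance_system setT w omega p].
Proof.
move=> symw w0 conn.
have [r _|V0] := pickP (@predT V); last first.
  by exists (fun _ _ => 0), (fun _ => 0); split=> // x; have := V0 x.
pose lap (a : V -> R) x := \sum_u w x u * (a x - a u).
(* Summation by parts: [b = a] leads to the energy of [a], and [b = 1] shows that a Laplacian sums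
   to zero. *)
have lap_swap (a b : V -> R) : \sum_x \sum_u w x u * (b x * (a x - a u)) =
    - \sum_x \sum_u w x u * (b u * (a x - a u)).
  rewrite exchange_big /= -sumrN; apply: eq_bigr => x _; rewrite -sumrN;
    apply: eq_bigr => u _.
  by rewrite symw; ring.
(* The Laplacian plus e_r e_r^T, which is symmetric and invertible. *)
pose M : 'M[R]_#|V| := \matrix_(i, j) ((i == j)%:R * (\sum_u w (enum_val i) u) -
   w (enum_val i) (enum_val j) + ((enum_val i == r) && (enum_val j == r))%:R).
have symM : M^T = M.
  apply/matrixP => i j; rewrite !mxE symw andbC; congr (_ - _ + _).
  by rewrite eq_sym; case: eqP => [->|]; rewrite ?mul0r.
have mulM (a : V -> R) i : (M *m \col_j a (enum_val j)) i 0 =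
    lap a (enum_val i) + (enum_val i == r)%:R * a r.
  rewrite mxE; under eq_bigr do rewrite !mxE mulrDl mulrBl.
  rewrite big_split sumrB /=; congr (_ + _); last first.
    rewrite (bigD1 (enum_rank r)) //= enum_rankK eqxx andbT big1 ?addr0 // => j.
    by rewrite -(inj_eq enum_val_inj) enum_rankK => /negPf ->; rewrite andbF mul0r.
  rewrite (bigD1 i) //= eqxx mul1r [X in _ + X - _]big1 ?addr0; last first.
    by move=> j ji; rewrite eq_sym (negPf ji) !mul0r.
  rewrite /lap mulr_suml; under [RHS]eq_bigr do rewrite mulrBr.
  rewrite sumrB; congr (_ - _).
  by rewrite [RHS](reindex (@enum_val V V)) //; apply: onW_bij; apply: enum_val_bij.
have Minj (a : V -> R) : (forall x, lap a x + (x == r)%:R * a r = 0) -> forall x,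
  a x = 0.
  move=> Ma.
  (* Pairing [a] with the equation gives a sum of nonnegative terms, so [a] vanishes at [r] and is
     constant along positive weights. *)
  have E0 : \sum_x \sum_u w x u * (a x - a u) ^+ 2 + 2 * a r ^+ 2 = 0.
    transitivity (2 * \sum_x a x * (lap a x + (x == r)%:R * a r)); last first.
      by rewrite big1 ?mulr0 // => x _; rewrite Ma mulr0.
    under [X in _ = 2 * X]eq_bigr do rewrite mulrDr.
    rewrite big_split /= mulrDr; congr (_ + _); last first.
      rewrite (bigD1 r) //= eqxx mul1r expr2 big1 ?addr0 // => x /negPf ->.
      by rewrite mul0r mulr0.
    transitivity (\sum_x \sum_u w x u * (a x * (a x - a u)) - \sum_x \sum_u w x u
      * (a u * (a x - a u))).
      rewrite -sumrB; apply: eq_bigr => x _; rewrite -sumrB;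
        apply: eq_bigr => u _; ring.
    have -> : \sum_x a x * lap a x = \sum_x \sum_u w x u * (a x * (a x - a u)).
      by apply: eq_bigr => x _; rewrite /lap mulr_sumr; apply: eq_bigr => u _; ring.
    have := lap_swap a a; lra.
  have S0 : 0 <= \sum_x \sum_u w x u * (a x - a u) ^+ 2.
    by apply: sumr_ge0 => x _; apply: sumr_ge0 => u _; rewrite mulr_ge0 ?sqr_ge0.
  have ar0 : a r = 0.
    by apply/eqP; rewrite -sqrf_eq0 eq_le sqr_ge0 andbT; have := sqr_ge0 (a r); lra.
  have aconst x u : 0 < w x u -> a x = a u.
    move=> wxu; apply/eqP; rewrite -subr_eq0 -sqrf_eq0.
    move: E0; rewrite ar0 expr0n mulr0 addr0 => /eqP.
    rewrite psumr_eq0 => [/allP/(_ x (mem_index_enum _))/=|y _]; last first.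
      by apply: sumr_ge0 => z _; rewrite mulr_ge0 ?sqr_ge0.
    rewrite psumr_eq0 => [/allP/(_ u (mem_index_enum _))/=|z _]; last first.
      by rewrite mulr_ge0 ?sqr_ge0.
    by rewrite mulf_eq0 gt_eqF.
  move=> x; rewrite -ar0; case/connectP: (conn x r) => p + ->.
  by elim: p x => //= y p IH x /andP[/aconst -> /IH].
have Mu : M \in unitmx.
  rewrite unitmxE unitfE; apply/negP => /det0P[phi /negP phi0 phiM]; apply: phi0.
  apply/eqP/rowP => i; rewrite mxE -[i]enum_valK.
  apply: (Minj (fun x => phi 0 (enum_rank x))) => x.
  rewrite -[x]enum_rankK -mulM -{1}symM.
  rewrite (_ : \col_j _ = phi^T); last by apply/colP => j; rewrite !mxE enum_valK.
  by rewrite -trmx_mul phiM !mxE.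
pose g x y := invmx M (enum_rank x) (enum_rank y).
have symg x y : g x y = g y x.
  by rewrite /g -[in LHS]symM -trmx_inv mxE.
have lapg x y : lap (g^~ y) x + (x == r)%:R * g r y = (x == y)%:R.
  rewrite -{1 2}[x]enum_rankK -mulM.
  have -> : \col_j g (enum_val j) y = col (enum_rank y) (invmx M).
    by apply/colP => j; rewrite !mxE /g enum_valK.
  by rewrite colE mulmxA mulmxV // mul1mx mxE (inj_eq enum_rank_inj) andbT.
(* Summing over [x] kills the Laplacian. The term at [r] thus does not depend on [y] and can be
   absorbed into [p]. *)
have gr y : g r y = 1.
  have : \sum_x (lap (g^~ y) x + (x == r)%:R * g r y) = 1.
    under eq_bigr do rewrite lapg.
    by rewrite (bigD1 y) //= eqxx big1 ?addr0 // => x /negPf ->.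
  rewrite big_split /= (_ : \sum_x lap (g^~ y) x = 0) ?add0r.
    rewrite (bigD1 r) //= eqxx mul1r big1 ?addr0 // => x /negPf ->; exact: mul0r.
  suff : \sum_x lap (g^~ y) x = - \sum_x lap (g^~ y) x by lra.
  have := lap_swap (g^~ y) (fun=> 1); rewrite /lap /=.
  by under eq_bigr do under eq_bigr do rewrite mul1r.
exists (fun x y => g x x + g y y - 2 * g x y).
exists (fun x => lap (fun y => g y y) x / 2 + (x == r)%:R); split.
- by move=> x y; rewrite symg; ring.
- by move=> x; ring.
move=> x v _ _; under eq_bigl do rewrite in_setT.
transitivity (lap (fun y => g y y) x - 2 * lap (g^~ v) x).
  by rewrite /lap mulr_sumr -sumrB; apply: eq_bigr => u _; ring.
by have := lapg x v; rewrite gr; set A := lap _ _; set B := lap _ _ => H; lra.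
Qed.

(** * Walks through an eliminated set *)

Section Through.
Variable G : sgraph.

(** Only the start of a step must lie in [U], so a walk may step out of [U] but stops there. *)
Definition leave (U : {set G}) : rel G := [rel a b | (a \in U) && adj a b].

(* Some walk from x to y with at least one edge has all its inner vertices in U. *)
Definition through (U : {set G}) (x y : G) : bool :=
  [exists u, adj x u && connect (leave U) u y].

Lemma throughP (U : {set G}) x y :
  reflect (exists2 u, adj x u & connect (leave U) u y) (through U x y).
Proof. exact: exists_inP. Qed.

Lemma connect_leaveS (U W : {set G}) x y : U \subset W ->
  connect (leave U) x y -> connect (leave W) x y.
Proof.
move=> /subsetP UW; apply: connect_sub => a b /= /andP[aU ab].
by apply: connect1; rewrite /leave /= UW.
Qed.

Lemma through0 x y : through set0 x y = adj x y.
Proof.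
apply/throughP/idP => [[u xu /connectP[[|z p] /=]]|xy]; last by exists y.
  by move=> _ ->.
by rewrite /leave /= in_set0.
Qed.

(** A walk with [z] as an inner vertex is cut at its first and last visits to [z]. This mirrors the
    two terms of the star-mesh weight. *)
Lemma throughU1 (U : {set G}) z x y :
  through (z |: U) x y = through U x y || through U x z && through U z y.
Proof.
apply/throughP/orP => [[u xu /connectP[p pp yl]] | [|/andP[]] /throughP[u xu uy]].
- suff : connect (leave U) u y \/ connect (leave U) u z /\ through U z y.
    case=> [uy|[uz ->]]; [left|right; rewrite andbT]; by apply/throughP; exists u.
  elim: p u {xu} pp yl => [|b p IH] a pp yl; first by left; rewrite yl /=.
  move: pp; rewrite /leave /= !inE => /andP[/andP[/orP aU ab] /IH/(_ yl) IHb].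
  case: aU => [/eqP az|aU].
    right; rewrite az; split=> //; rewrite -az.
    by case: IHb => [by_|[_]]; last rewrite az //; apply/throughP; exists b.
  have aUb : connect (leave U) a b by apply: connect1; rewrite /leave /= aU.
  by case: IHb => [by_|[bz zy]]; [left|right; split=> //];
    apply: connect_trans aUb _.
- by exists u => //; apply: connect_leaveS uy; apply: subsetU1.
case/throughP=> t zt ty; exists u => //.
have S := subsetU1 z U.
apply: connect_trans (connect_leaveS S uy) (connect_trans (connect1 _)
  (connect_leaveS S ty)).
by rewrite /leave /= setU11.
Qed.

End Through.

(** * Star-mesh elimination of vertices *)

Section Elimination.
Variables (R : realFieldType) (V : finType).

(** Gaussian elimination: row [z] times [w x z / s] is added to row [x]. Since [y] differs from [z],
    the right-hand side of row [z] is just [2 * p z]. *)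
Lemma eliminate_vertex (A : {set V}) (z : V) (w omega : V -> V -> R) (p : V -> R) :
  (forall x y, w x y = w y x) -> (forall x y, 0 <= w x y) -> z \in A ->
  resistance_system A w omega p ->
  let s := \sum_(u in A :\ z) w z u in
  resistance_system (A :\ z) (fun x y => w x y + w x z * w z y / s) omega
    (fun x => p x + w x z / s * p z).
Proof.
move=> symw w0 zA sys s x y; rewrite !inE => /andP[xz xA] /andP[yz yA].
have := sys _ _ xA yA; have := sys _ _ zA yA.
rewrite !(big_setD1 z zA) /= subrr mulr0 add0r [z == y]eq_sym (negPf yz) subr0 =>
  Sz Sx.
have -> : \sum_(u in A :\ z) (w x u + w x z * w z u / s) * (omega x y - omega u y) =
    \sum_(u in A :\ z) w x u * (omega x y - omega u y) +
    w x z / s * (s * (omega x y - omega z y) +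
      \sum_(u in A :\ z) w z u * (omega z y - omega u y)).
  rewrite [s * _]mulr_suml -big_split mulr_sumr -big_split /=.
  by apply: eq_bigr => u _; ring.
rewrite Sz (_ : \sum_(u in A :\ z) w x u * (omega x y - omega u y) =
  2 * (p x - (x == y)%:R) - w x z * (omega x y - omega z y));
    last by rewrite -Sx; ring.
(* If s = 0 the divisions by s give 0, and z has no neighbour left in A. *)
have [s0|s0] := eqVneq s 0; last by field.
suff -> : w x z = 0 by ring.
move/eqP: s0; rewrite psumr_eq0 => [/allP/(_ x (mem_index_enum _))|//].
by rewrite /= !inE xz xA symw => /eqP.
Qed.

End Elimination.

(** Induction on the size of [U]. Nonnegative weights cannot cancel, so their support follows the
    recursion of [throughU1]. *)
Lemma eliminate_set (R : realFieldType) (G : sgraph) (w omega : G -> G -> R) (p :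
  G -> R) (U : {set G}) :
  (forall x y, w x y = w y x) -> (forall x y, 0 <= w x y) ->
  (forall x y, x != y -> (0 < w x y) = adj x y) ->
  (forall x, 0 <= p x) -> resistance_system setT w omega p ->
  exists w' p', [/\ forall x y, w' x y = w' y x, forall x y, 0 <= w' x y,
    forall x y, x \notin U -> y \notin U -> x != y -> (0 < w' x y) = through U x y,
    resistance_system (~: U) w' omega p' & forall x, p x <= p' x].
Proof.
move=> symw w0 wadj p0 sys.
elim: {U}#|U| {-2}U (erefl #|U|) => [|n IH] U cU.
  exists w, p; have -> : U = set0 by apply/eqP; rewrite -cards_eq0 cU.
  by split=> // [x y _ _ xy|]; rewrite ?through0 ?wadj // setC0.
have [z zU] : exists z, z \in U by apply/set0Pn; rewrite -cards_eq0 cU.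
have := IH (U :\ z); rewrite (cardsD1 z) zU in cU; case: cU => cU /(_ cU).
move=> [w' [p' [symw' w'0 w'U sys' pp']]].
have zUC : z \in ~: (U :\ z) by rewrite !inE eqxx.
have := eliminate_vertex symw' w'0 zUC sys'.
have -> : ~: (U :\ z) :\ z = ~: U.
  by apply/setP => x; rewrite !inE; case: eqVneq => [->|//]; rewrite zU.
set s := \sum_(u in ~: U) w' z u => /= sysU.
have s0 : 0 <= s by apply: sumr_ge0.
exists (fun x y => w' x y + w' x z * w' z y / s), (fun x =>
  p' x + w' x z / s * p' z).
split=> //.
- by move=> x y; rewrite symw' [w' x z]symw' [w' z y]symw' [w' z x * _]mulrC.
- by move=> x y; rewrite addr_ge0 ?mulr_ge0 ?invr_ge0.
- move=> x y xU yU xy.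
  have xz : x != z by apply: contraNneq xU => ->.
  have zy : z != y by apply: contraNneq yU => <-.
  rewrite -[in RHS](setD1K zU) throughU1 -!w'U // ?inE ?negb_and ?xU ?yU ?eqxx
    ?orbT //.
  have [xy0|xy0] := ltP 0 (w' x y); first by rewrite ltr_pwDl // ?mulr_ge0
    ?invr_ge0.
  have -> : w' x y = 0 by apply/eqP; rewrite eq_le xy0 w'0.
  rewrite add0r /=; have [xz0|xz0] := ltP 0 (w' x z); last first.
    by rewrite (_ : w' x z = 0) ?mul0r ?ltxx //; apply/eqP; rewrite eq_le xz0 w'0.
  have [zy0|zy0] := ltP 0 (w' z y); last first.
    by rewrite (_ : w' z y = 0) ?mulr0 ?mul0r ?ltxx //; apply/eqP;
      rewrite eq_le zy0 w'0.
  (* The divisor [s] is positive because [w' z y] is one of its terms. *)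
  rewrite divr_gt0 ?mulr_gt0 // /s (bigD1 y) ?inE //= ltr_pwDl // sumr_ge0 //.
by move=> x; rewrite (le_trans (pp' x)) // lerDl !mulr_ge0 ?invr_ge0 // (le_trans
  (p0 z)).
Qed.

(** Symmetry makes the order of the picked pair immaterial; [x0] is the value on sets that are not
    of the form [[set x; y]]. *)
Lemma set2_weights (T : finType) (X : Type) (x0 : X) (w : T -> T -> X) :
  (forall x y, w x y = w y x) -> exists c : {set T} -> X, forall x y, c [set x;
    y] = w x y.
Proof.
move=> symw; exists (fun e => if [pick z : T * T | e == [set z.1;
  z.2]] is Some z then w z.1 z.2 else x0).
move=> x y; case: pickP => [z /eqP /eq_set2[[-> ->]|[-> ->]] //|/(_ (x, y))].
by rewrite eqxx.
Qed.

(** * Curvature after elimination, for a graph whose edges are the pairs joined through [U] *)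

Section KronCurvature.
Variables (R : realType) (G : sgraph) (U : {set G}).
Variables (e : rel {v : G | v \notin U}) (e_sym : symmetric e) (e_irr :
  irreflexive e).
Hypothesis eE : forall x y, e x y = (x != y) && through U (val x) (val y).
Hypothesis cG : connected G.

Let H := SGraph e_sym e_irr.

Lemma kron_connected : connected H.
Proof.
move=> x y.
have /connectP[p pp yl] := cG (val x) (val y).
(* The walk is followed from any vertex, possibly in [U]; [z] is then the first vertex met outside
   [U]. *)
suff : exists2 z : H, connect (leave U) (val x) (val z) & connect (@adj H) z y.
  case=> z /connectP[[|a q] /=]; first by move=> _ /val_inj ->.
  by rewrite /leave /= (negPf (valP x)).
elim: p {x}(val x) pp yl => [|b p IH] a /= => [_ yl|/andP[ab pb] yl].
  by exists y => //; rewrite -yl.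
have [z bz zy] := IH b pb yl.
have [aU|aU] := boolP (a \in U).
  by exists z => //; apply: connect_trans (connect1 _) bz; rewrite /leave /= aU.
exists (exist _ a aU : H) => //; have [->//|az] := eqVneq (exist _ a aU : H) z.
apply: connect_trans (connect1 _) zy; rewrite /= eE az; apply/throughP; by exists b.
Qed.

Lemma kron_curvature (c : {set G} -> R) : positive_weights c ->
  (forall v, 0 <= curvature c v) ->
  exists2 c' : {set H} -> R, positive_weights c' &
    forall x : H, curvature c (val x) <= curvature c' x.
Proof.
move=> c0 curv0.
have w0 x y : 0 <= conductance c x y.
  by rewrite /conductance; case: ifP => // xy; rewrite ltW // c0 // edges_adj.
have wadj x y : x != y -> (0 < conductance c x y) = adj x y.
  by rewrite /conductance; case: ifP => [xy _|]; rewrite ?ltxx // c0 ?edges_adj.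
have [omega [p [symo diago sys]]] : exists omega p, [/\ forall x y, omega x y =
  omega y x,
    forall x, omega x x = 0 & resistance_system setT (conductance c) omega p].
  apply: resistance_exists w0 _; first exact: conductance_sym.
  move=> x y; apply: connect_sub (cG x y) => a b ab; apply: connect1.
  by rewrite /= wadj //; apply: contraTneq ab => ->; rewrite adj_irr.
have curvp v : curvature c v = p v by apply: curvature_resistance sys v.
have p0 x : 0 <= p x by rewrite -curvp.
have [w [q [symw w'0 wU sysU pq]]] := eliminate_set U (conductance_sym c) w0 wadj
  p0 sys.
have [c' c'E] := set2_weights 0 (fun x y : H => symw (val x) (val y)).
have c'0 : positive_weights c'.
  move=> _ /imset2P[x y _ + ->]; rewrite inE /= eE => /andP[xy thr].
  by rewrite c'E wU ?(valP x) ?(valP y).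
exists c' => // x; rewrite curvp (le_trans (pq (val x))) //.
rewrite (curvature_resistance (omega := fun x y : H =>
  omega (val x) (val y)) (p := q \o val) kron_connected c'0) //.
move=> {}x y _ _; rewrite /= -sysU ?inE ?(valP x) ?(valP y) //.
have -> : ~: U = [set val u | u in [set: H]].
  apply/setP => v; rewrite inE; apply/idP/imsetP => [vU|[u _ ->]];
    last exact: (valP u).
  by exists (exist _ v vU).
rewrite big_imset /=; last by move=> ? ? _ _; apply: val_inj.
apply: eq_bigr => u _; rewrite /conductance /=.
(* The diagonal of [w] need not vanish as that of [conductance] does, but its factor in the system
   is zero. *)
have [->|xu] := eqVneq x u; first by rewrite e_irr subrr !mulr0.
rewrite c'E; case: ifPn => //; rewrite eE xu /= -wU ?(valP x) ?(valP u) //.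
by rewrite lt_neqAle w'0 andbT negbK => /eqP <-; rewrite !mul0r.
Qed.

End KronCurvature.

(** * Adding edges of small weight *)

Section Perturbation.
Variables (R : realType) (V : finType) (e1 e2 : rel V).
Variables (sym1 : symmetric e1) (irr1 : irreflexive e1).
Variables (sym2 : symmetric e2) (irr2 : irreflexive e2).
Hypothesis e12 : subrel e1 e2.
Let G1 := SGraph sym1 irr1.
Let G2 := SGraph sym2 irr2.
Hypothesis cG1 : connected G1.

(** Clearing the positive denominator leaves an expression polynomial in the weights. *)
Lemma curvature_gt0 (G : sgraph) (c : {set G} -> R) (v : G) : connected G ->
  positive_weights c ->
  (0 < curvature c v) = (0 < 2 * treesum v [set v] (conductance c) -
     \sum_u conductance c u v * treesum v [set u; v] (conductance c)).
Proof.
move=> cG c0; have D0 := treesum_gt0 cG c0 v.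
rewrite curvature_treesum // -mulr_suml -[RHS](pmulr_lgt0 _ (_ : 0 < (2 * treesum
  v [set v] (conductance c))^-1)).
  by congr (0 < _); field; rewrite gt_eqF.
by rewrite invr_gt0 mulr_gt0.
Qed.

Lemma horner_treesum (v : V) (S : {set V}) (w : V -> V -> {poly R}) t :
  (treesum v S w).[t] = treesum v S (fun x y => (w x y).[t]).
Proof. by rewrite horner_sum; apply: eq_bigr => f _; rewrite horner_prod. Qed.

Lemma horner_gt0_near0 (P : V -> {poly R}) : (forall v : V, 0 < (P v).[0]) ->
  exists2 t, 0 < t & forall v : V, 0 < (P v).[t].
Proof.
move=> P0.
have bound : forall v : V, exists k : R, forall t, 0 <= t <= 1 -> (P v).[0] - t *
  `|k| <= (P v).[t].
  move=> v; have /factor_theorem[q qE] : root (P v - (P v).[0]%:P) 0 by rewrite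
    /root !hornerE subrr.
  have [k kP] := poly_disk_bound q 1; exists k => t /andP[t0 t1].
  have -> : (P v).[t] = (P v).[0] + t * q.[t].
    have := congr1 (horner^~ t) qE; rewrite !hornerE => E; lra.
  rewrite lerD2l -mulrN ler_wpM2l // (le_trans _ (lerNnormlW (lexx _))) // lerN2.
  by apply: le_trans (kP _ _) (ler_norm _); rewrite ger0_norm.
have [K KP] := boolp.choice bound.
(* The added one makes the divisor positive and the final inequality strict: [t * (|K v| + 1)] is at
   most [(P v).[0]]. The default 1 of the minimum below keeps [t] within the range of the bound. *)
pose d v := (P v).[0] / (`|K v| + 1).
have d0 v : 0 < d v by rewrite divr_gt0 // ltr_wpDl.
exists (\big[Num.min/1]_v d v); first by apply: lt_bigmin.
set t := \big[_/_]_v _ => v.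
have t0 : 0 < t by apply: lt_bigmin.
have td : t <= d v by apply: bigmin_le.
have t1 : t <= 1 by apply: bigmin_le_id.
apply: lt_le_trans (KP v t _); last by rewrite ltW.
have K1 : 0 < `|K v| + 1 by rewrite ltr_wpDl.
move: td; rewrite /d (ler_pdivlMr _ _ K1) mulrDr mulr1 => td; lra.
Qed.

Lemma resistance_positive_subgraph : resistance_positive R G1 ->
  resistance_positive R G2.
Proof.
move=> [c c0 curv0].
have cG2 : connected G2.
  by move=> x y; apply: connect_sub (cG1 x y) => a b /e12; apply: connect1.
(* Edges of [G2] missing from [G1] get the indeterminate as weight: evaluation at zero gives back
   [G1], and evaluation at [t] gives the weights [ct t] on [G2]. *)
pose W x y : {poly R} := (@conductance R G1 c x y)%:P + (if e2 x y && ~~ e1 x y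
  then 'X else 0).
pose P (v : V) := 2%:P * treesum v [set v] W - \sum_u W u v * treesum v [set u; v] W.
pose ct t (e : {set G2}) : R := if e \in edges G1 then c e else t.
have WE t x y : (W x y).[t] = conductance (ct t) x y.
  rewrite /conductance /ct /W hornerD hornerC /conductance (@edges_adj G1) /=.
  case: ifP => [/[dup] /e12 -> _|_]; first by rewrite hornerC addr0.
  by rewrite add0r andbT; case: ifP; rewrite ?hornerX ?hornerC.
have W0 x y : (W x y).[0] = @conductance R G1 c x y.
  by rewrite /W hornerD hornerC; case: ifP; rewrite ?hornerX ?hornerC addr0.
have PE t w v : (forall x y, (W x y).[t] = w x y) ->
    (P v).[t] = 2 * treesum v [set v] w - \sum_u w u v * treesum v [set u; v] w.
  move=> Ww; have trE S : (treesum v S W).[t] = treesum v S w.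
    by rewrite horner_treesum; apply: eq_bigr => f _; apply: eq_bigr => x _.
  rewrite hornerD hornerN hornerM hornerC trE horner_sum; congr (_ - _).
  by apply: eq_bigr => u _; rewrite hornerM trE Ww.
have [v|t t0 Pt] := @horner_gt0_near0 P.
  by rewrite (PE _ _ _ W0) -(@curvature_gt0 G1).
have ct0 : positive_weights (ct t).
  by move=> e _; rewrite /ct; case: ifP => // /c0.
exists (ct t) => // v.
by rewrite curvature_gt0 // -(PE _ _ _ (WE t)).
Qed.

End Perturbation.

(** * Adjacency in the Kron reductions as walks through [U] *)

Section KronThrough.
Variables (G : sgraph) (U : {set G}).

Lemma connect_leave_out x y : x \notin U -> connect (leave U) x y -> x = y.
Proof. by move=> xU /connectP[[|z p]] //=; rewrite /leave /= (negPf xU). Qed.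

Lemma connect_adj_in x y : x \in U -> connect (adj_in U) x y -> y \in U.
Proof.
move=> xU /connectP[p + ->]; elim: p x xU => //= z p IH x xU /andP[/and3P[_ zU _]].
exact: IH.
Qed.

Lemma connect_adj_in_sym : connect_sym (adj_in U).
Proof.
by apply: sym_connect_sym => x y; rewrite /adj_in /= andbCA adj_sym.
Qed.

Lemma connect_leave_last x y : x \in U -> y \notin U -> connect (leave U) x y ->
  exists2 z, connect (adj_in U) x z & adj z y.
Proof.
move=> xU yU /connectP[p pp yl].
elim: p x xU pp yl => [|z p IH] x xU /=; first by move=> _ yx; rewrite yx xU in yU.
move=> /andP[/andP[_ xz] pp] yl; have [zU|zU] := boolP (z \in U).
  have [t zt ty] := IH z zU pp yl; exists t => //.
  by apply: connect_trans zt; apply: connect1; rewrite /adj_in /= xU zU.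
exists x => //; rewrite -(connect_leave_out zU (y := y)) //.
by apply/connectP; exists p.
Qed.

Lemma boundary_component u x : u \in U -> x \notin U ->
  reflect (exists2 z, connect (adj_in U) u z & adj z x)
  (x \in boundary (component U u)).
Proof.
move=> uU xU; rewrite inE (_ : x \notin component U u) /=.
  by apply: (iffP exists_inP) => -[z]; rewrite ?inE => uz zx; exists z;
    rewrite ?inE.
by rewrite inE; apply: contra xU; apply: connect_adj_in.
Qed.

(** The inner vertices of a walk through [U] stay in one component of [U]; conversely, two boundary
    vertices of a component are joined by a walk inside it. *)
Lemma kron_comp_adj_through (x y : {v : G | v \notin U}) :
  kron_comp_adj x y = (x != y) && through U (val x) (val y).
Proof.
case: x y => x xU [y yU]; rewrite /kron_comp_adj /=; congr (_ && _).
apply/orP/throughP => [[xy|/exists_inP[u uU /andP[]]] | [u xu uy]].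
- by exists y.
- move=> /(boundary_component uU xU)[z uz zx] /(boundary_component uU yU)[t ut ty].
  exists z; first by rewrite adj_sym.
  apply: connect_trans (connect1 (_ : leave U t y)); last first.
    by rewrite /leave /= (connect_adj_in uU ut).
  have : connect (adj_in U) z t by apply: connect_trans ut;
    rewrite connect_adj_in_sym.
  apply: connect_sub => a b /and3P[aU _ ab]; apply: connect1; exact/andP.
have [uU|uU] := boolP (u \in U); last by left; rewrite -(connect_leave_out uU uy).
right; apply/exists_inP; exists u => //; apply/andP; split;
  apply/(boundary_component uU) => //.
  by exists u => //; rewrite adj_sym.
exact: connect_leave_last.
Qed.

(** A connected [U] is the only component of itself, so both reductions agree. *)
Lemma kron_adj_through (x y : {v : G | v \notin U}) : connected_set U ->
  kron_adj x y = (x != y) && through U (val x) (val y).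
Proof.
move=> cU; rewrite -kron_comp_adj_through /kron_adj /kron_comp_adj /=.
congr (_ && (_ || _)).
have compU u : u \in U -> component U u = U.
  move=> uU; apply/setP => z; rewrite inE; apply/idP/idP;
    first exact: connect_adj_in.
  by move=> zU; apply: cU.
apply/idP/exists_inP => [xy|[u /compU -> //]].
have /andP[+ _] := xy; rewrite inE => /andP[_ /exists_inP[u uU _]].
by exists u => //; rewrite compU.
Qed.

Lemma kron_comp_adj_sub (x y : {v : G | v \notin U}) : kron_comp_adj x y ->
  kron_adj x y.
Proof.
case: x y => x xU [y yU] /andP[xy adjxy]; rewrite /kron_adj /= [_ != _]xy /=.
case/orP: adjxy => [->//|/exists_inP[u uU /andP[xu yu]]]; apply/orP; right.
apply/andP; split; rewrite inE.
  have [z uz zx] := boundary_component uU xU xu.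
  by rewrite xU; apply/exists_inP; exists z => //; apply: connect_adj_in uz.
have [z uz zy] := boundary_component uU yU yu.
by rewrite yU; apply/exists_inP; exists z => //; apply: connect_adj_in uz.
Qed.

End KronThrough.

Theorem proposition6p14 (R : realType) (G : sgraph) (hG : connected G) :
  (resistance_nonnegative R G ->
     (forall U : {set G}, connected_set U -> resistance_nonnegative R (kron U)) /\
     (forall U : {set G}, resistance_nonnegative R (kron_comp U))) /\
  (resistance_positive R G ->
     forall U : {set G}, resistance_positive R (kron U)).
Proof.
split=> [[c c0 curv0]|[c c0 curv0] U]; last first.
  (* Elimination makes [kron_comp U] positive; the further edges of [kron U] are then added by
     perturbation. *)
  apply: (@resistance_positive_subgraph R _ _ _ (@kron_comp_adj_sym G U)
    (@kron_comp_adj_irr G U)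
    (@kron_adj_sym G U) (@kron_adj_irr G U) (@kron_comp_adj_sub G U)).
    by apply: kron_connected hG; apply: kron_comp_adj_through.
  have [|c' c'0 cc'] := kron_curvature (@kron_comp_adj_sym G U)
    (@kron_comp_adj_irr G U) (@kron_comp_adj_through G U) hG c0.
    by move=> v; apply/ltW/curv0.
  by exists c' => // v; apply: lt_le_trans (cc' v).
split=> [U cU|U].
  (* Here elimination yields weights on [kron U] directly, its edges being exactly the pairs joined
     through the connected [U]. *)
  have [c' c'0 cc'] := kron_curvature (@kron_adj_sym G U) (@kron_adj_irr G U)
    (fun x y => kron_adj_through x y cU) hG c0 curv0.
  by exists c' => // v; apply: le_trans (cc' v).
have [c' c'0 cc'] := kron_curvature (@kron_comp_adj_sym G U) (@kron_comp_adj_irr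
  G U) (@kron_comp_adj_through G U) hG c0 curv0.
by exists c' => // v; apply: le_trans (cc' v).
Qed.
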